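(* Let $1\le j<k$, let $p_1,\dots,p_k$ be distinct primes, and let $G=S_{p_1}\times\cdots\times S_{p_j}\times\mathbb{Z}_s$, where $S_{p_i}=\mathbb{Z}_{p_i^{e_i}}\times\mathbb{Z}_{p_i^{t_i}}$ with $1\le t_i\le e_i$ for $1\le i\le j$, and $s=\prod_{i=j+1}^{k}p_i^{e_i}$ with $e_{j+1},\dots,e_k\ge1$. Then $$\Gamma(G)=\Bigl(\bigotimes_{i=1}^{j}\Gamma(S_{p_i})\Bigr)\otimes\widehat{\Gamma}(\mathbb{Z}_s).$$
   Context: The generating graph $\Gamma(G)$ of a group $G$ is the simple graph with vertex set $G$ in which two distinct vertices $x,y$ are adjacent if and only if $\langle x,y\rangle=G$. The looped generating graph $\widehat{\Gamma}(\mathbb{Z}_s)$ is $\Gamma(\mathbb{Z}_s)$ with a loop added at each vertex that generates $\mathbb{Z}_s$. The Kronecker product $\mathcal{G}_1\otimes\mathcal{G}_2$ has vertex set $V(\mathcal{G}_1)\times V(\mathcal{G}_2)$, with $(u_1,v_1)$ adjacent to $(u_2,v_2)$ if and only if $u_1u_2\in E(\mathcal{G}_1)$ and $v_1v_2\in E(\mathcal{G}_2)$, where the case $v_1=v_2$ is allowed when $\mathcal{G}_2$ has a loop at $v_1$. *)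

(* Defs.v *)
From HB Require Import structures.
From mathcomp Require Import all_boot all_algebra all_fingroup.

Set Implicit Arguments.
Unset Strict Implicit.
Unset Printing Implicit Defensive.

(* Finite undirected graphs without multiple edges; a loop at x is adj x x.
   A simple graph is one whose adj is moreover irreflexive. *)
Record graph := Graph {
  vertex : finType;
  adj : rel vertex;
  adj_sym : symmetric adj
}.

Definition gen_adj (gT : finGroupType) (x y : gT) : bool :=
  (x != y) && (<<[set x; y]>> == [set: gT])%g.

Lemma gen_adj_sym (gT : finGroupType) : symmetric (@gen_adj gT).
Proof. by move=> x y; rewrite /gen_adj eq_sym setUC. Qed.

Definition generating_graph (gT : finGroupType) : graph :=
  Graph (@gen_adj_sym gT).

Lemma generating_graph_irr (gT : finGroupType) :
  irreflexive (@adj (generating_graph gT)).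
Proof. by move=> x; rewrite /= /gen_adj eqxx. Qed.

Definition looped_gen_adj (gT : finGroupType) (x y : gT) : bool :=
  gen_adj x y || (x == y) && (<[x]> == [set: gT])%g.

Lemma looped_gen_adj_sym (gT : finGroupType) : symmetric (@looped_gen_adj gT).
Proof.
move=> x y; rewrite /looped_gen_adj gen_adj_sym eq_sym.
by case: eqP => // ->.
Qed.

Definition looped_generating_graph (gT : finGroupType) : graph :=
  Graph (@looped_gen_adj_sym gT).

Definition kron_adj (A B : graph) (u v : vertex A * vertex B) : bool :=
  adj u.1 v.1 && adj u.2 v.2.

Lemma kron_adj_sym (A B : graph) : symmetric (@kron_adj A B).
Proof. by move=> u v; rewrite /kron_adj adj_sym [adj u.2 _]adj_sym. Qed.

Definition kronecker (A B : graph) : graph := Graph (@kron_adj_sym A B).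

(* The Kronecker product of a finite family. Its vertices are the dependent
   functions, which is also how the group structure of a finite direct product
   is set up in gproduct; bigkronecker_recr below identifies it with the
   iterated binary product. *)
Definition bigkron_adj (I : finType) (A : I -> graph)
    (u v : {dffun forall i, vertex (A i)}) : bool :=
  [forall i, adj (u i) (v i)].

Lemma bigkron_adj_sym (I : finType) (A : I -> graph) :
  symmetric (@bigkron_adj I A).
Proof. by move=> u v; apply: eq_forallb => i; rewrite adj_sym. Qed.

Definition bigkronecker (I : finType) (A : I -> graph) : graph :=
  Graph (@bigkron_adj_sym I A).

Lemma bigkronecker_recr (n : nat) (A : 'I_n.+1 -> graph) :
  exists2 f : vertex (bigkronecker A) ->
              vertex (kronecker (bigkronecker (fun i => A (lift ord_max i)))
                                (A ord_max)),
    bijective f & forall u v, adj (f u) (f v) = adj u v.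
Proof.
pose f (u : {dffun forall i, vertex (A i)}) :
    {dffun forall i : 'I_n, vertex (A (lift ord_max i))} * vertex (A ord_max)
  := (finfun (fun i => u (lift ord_max i)), u ord_max).
pose g (v : {dffun forall i : 'I_n, vertex (A (lift ord_max i))}
            * vertex (A ord_max)) : {dffun forall i, vertex (A i)}
  := finfun (fun i => match unliftP ord_max i in unlift_spec _ _ o with
       | UnliftSome i' e => ecast i (vertex (A i)) (esym e) (v.1 i')
       | UnliftNone e => ecast i (vertex (A i)) (esym e) v.2
       end).
exists f; first exists g.
- move=> u; apply/ffunP => i; rewrite ffunE.
  by case: unliftP => [i'|] e; move: (esym e) => {e} e; case: i / e => //=; rewrite ffunE.
- case=> v w; congr pair.
    apply/ffunP => i; rewrite !ffunE; case: unliftP => [i' e|e]; last first.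
      by exfalso; move: (neq_lift ord_max i); rewrite e eqxx.
    have e' := lift_inj e; case: i' / e' e => e.
    by rewrite eq_axiomK.
  rewrite ffunE; case: unliftP => [i' e|e]; last by rewrite eq_axiomK.
  by exfalso; move: (neq_lift ord_max i'); rewrite -e eqxx.
move=> u v /=; apply/andP/forallP => [[/forallP uv uvm] i|uv]; last first.
  by split=> //; apply/forallP => i; rewrite !ffunE.
by case: (unliftP ord_max i) => [i'|] ->; [have := uv i'; rewrite !ffunE|].
Qed.

(* Main.v *)
(** The factors have pairwise coprime orders, so a subgroup of the product that
    projects onto every factor is the whole product, by Lagrange.  Hence a pair
    generates the product iff each of its components generates its factor.  As
    [S i] is not cyclic, a generating pair of [S i], and so one of the product,
    consists of distinct elements; in the cyclic factor the two components may
    coincide, which is what the loops record. *)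
Require Import Defs.
From HB Require Import structures.
From mathcomp Require Import all_boot all_algebra all_fingroup.
From mathcomp Require Import cyclic.
From Stdlib Require Import FunctionalExtensionality.

(** Extensionality identifies the relations, and the symmetry proofs agree because equalities
    between booleans have unique proofs. This gives equality of graphs on the same vertex type
    rather than a mere isomorphism. *)
Lemma graph_eq (T : finType) (a b : rel T) (sa : symmetric a)
    (sb : symmetric b) : a =2 b -> Graph sa = Graph sb.
Proof.
move=> eq_ab; have e : a = b.
  by do 2!apply: functional_extensionality => ?; exact: eq_ab.
subst b; congr Graph.
by do 2!apply: functional_extensionality_dep => ?; exact: eq_irrelevance.
Qed.

Lemma prod_dvdn_coprime (I : finType) (F : I -> nat) (m : nat) :
  (forall i l, i != l -> coprime (F i) (F l)) -> (forall i, F i %| m) ->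
  \prod_i F i %| m.
Proof.
move=> coF dvF; have := index_enum_uniq I.
elim: (index_enum I) => [|i r IHr] /=; first by rewrite big_nil dvd1n.
case/andP=> ri /IHr dvr; rewrite big_cons Gauss_dvd ?dvF //.
rewrite big_seq; apply: (big_ind (coprime (F i))) => [|a b|l lr];
  rewrite ?coprimen1 //.
  by rewrite coprimeMr => -> ->.
by apply: coF; apply: contraNneq ri => ->.
Qed.

Lemma card_dffun_prod (I : finType) (S : I -> finType) :
  #|{dffun forall i, S i}| = \prod_i #|S i|.
Proof. by rewrite card_dep_ffun foldrE big_image. Qed.

Section Projections.
Local Open Scope group_scope.

Lemma morphim_gen2T {aT rT : finGroupType} (f : {morphism [set: aT] >-> rT})
    (x y : aT) : f @* <<[set x; y]>> = <<[set f x; f y]>>.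
Proof. by rewrite morphim_gen ?subsetT // morphimU !morphim_set1 ?inE. Qed.

Lemma morphimT_surj {aT rT : finGroupType} (f : {morphism [set: aT] >-> rT}) g :
  cancel g f -> f @* [set: aT] = [set: rT].
Proof.
move=> gK; apply/setP=> z; rewrite [RHS]inE; apply/morphimP.
by exists (g z); rewrite ?inE.
Qed.

(** The order of a homomorphic image divides that of the source; below, [f] is a projection onto a
    factor. *)
Lemma gen2_card_dvd {aT rT : finGroupType} (f : {morphism [set: aT] >-> rT})
    (x y : aT) : <<[set f x; f y]>> = [set: rT] ->
  #|rT| %| #|<<[set x; y]>>|.
Proof.
by move=> gen; rewrite -cardsT -gen -morphim_gen2T dvdn_morphim.
Qed.

Lemma gen2_prod_coprime (I : finType) (S : I -> finGroupType)
    (T : finGroupType) (x y : ({dffun forall i, S i} * T)%type) :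
  (forall i l, i != l -> coprime #|S i| #|S l|) ->
  (forall i, coprime #|S i| #|T|) ->
  (<<[set x; y]>> == [set: ({dffun forall i, S i} * T)%type]) =
  [forall i, <<[set x.1 i; y.1 i]>> == [set: S i]] &&
  (<<[set x.2; y.2]>> == [set: T]).
Proof.
move=> coS coT.
pose f2 := snd_morphism {dffun forall i, S i} T.
have pi_morph i :
    {in [set: ({dffun forall i, S i} * T)%type] &,
      {morph (fun z : ({dffun forall i, S i} * T)%type => z.1 i) : a b / a * b}}.
  by move=> a b _ _ /=; rewrite ffunE.
pose pi i := Morphism (pi_morph i).
apply/idP/andP=> [/eqP gen | [/forallP gen1 /eqP gen2]].
  split; last first.
    by rewrite -(morphim_gen2T f2) gen (morphimT_surj _ (fun z => (1, z))).
  apply/forallP=> i; rewrite -(morphim_gen2T (pi i)) gen.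
  (* The section [dfung1 z] has [z] at coordinate [i] and 1 at all others. *)
  rewrite (morphimT_surj _ (fun z => (dfung1 z, 1))) // => z.
  exact: dfung1_id.
have dvS i : #|S i| %| #|<<[set x; y]>>|.
  by apply: (gen2_card_dvd (pi i)); apply/eqP/gen1.
have dvT : #|T| %| #|<<[set x; y]>>| by exact: (gen2_card_dvd f2).
rewrite eqEcard subsetT cardsT card_prod card_dffun_prod /=.
apply: dvdn_leq; first exact: cardG_gt0.
rewrite Gauss_dvd ?dvT ?andbT; first exact: prod_dvdn_coprime.
by apply: (big_ind (coprime^~ #|T|)) => [|a b|i _];
  rewrite ?coprime1n // coprimeMl => -> ->.
Qed.

End Projections.

Lemma card_Z (n : nat) : 1 < n -> #|'Z_n| = n.
Proof. by move=> n_gt1; rewrite card_ord Zp_cast. Qed.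

Lemma order_Z_dvd (n : nat) (x : 'Z_n) : 1 < n -> #[x]%g %| n.
Proof.
by move=> n_gt1; have := order_dvdG (in_setT x); rewrite cardsT card_Z.
Qed.

(** Since [n] divides [m], the [m]-th power kills both components, so [x] has order at most [m],
    which is less than [m * n]. *)
Lemma Z_prod_noncyclic (m n : nat) (x : ('Z_m * 'Z_n)%type) :
  1 < m -> 1 < n -> n %| m ->
  (<[x]> != [set: ('Z_m * 'Z_n)%type])%g.
Proof.
move=> m_gt1 n_gt1 dv_nm; apply/eqP=> gen.
have: #[x]%g %| m.
  rewrite order_dvdn [(x ^+ m)%g]surjective_pairing.
  have -> : (x ^+ m).1%g = (x.1 ^+ m)%g.
    by apply: (morphX (fst_morphism 'Z_m 'Z_n)); rewrite inE.
  have -> : (x ^+ m).2%g = (x.2 ^+ m)%g.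
    by apply: (morphX (snd_morphism 'Z_m 'Z_n)); rewrite inE.
  apply/eqP; congr pair; apply/eqP; rewrite -order_dvdn.
    exact: order_Z_dvd.
  by apply: dvdn_trans dv_nm; exact: order_Z_dvd.
rewrite /order gen cardsT card_prod !card_Z //.
have m_gt0 := ltnW m_gt1.
by move/(dvdn_leq m_gt0); rewrite leqNgt ltn_Pmulr.
Qed.

Lemma gen_adj_noncyclic (gT : finGroupType) (x y : gT) :
  (forall z : gT, <[z]> != [set: gT])%g ->
  gen_adj x y = (<<[set x; y]>> == [set: gT])%g.
Proof.
move=> ncyc; rewrite /gen_adj; case: eqP => //= ->; rewrite setUid.
by apply/esym/negbTE/ncyc.
Qed.

(** On the diagonal [[set x; y]] collapses to a singleton, and generation by it is exactly the loop
    condition. *)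
Lemma looped_gen_adjE (gT : finGroupType) (x y : gT) :
  looped_gen_adj x y = (<<[set x; y]>> == [set: gT])%g.
Proof.
by rewrite /looped_gen_adj /gen_adj; case: eqP => [->|_];
  rewrite /= ?setUid ?orbF.
Qed.

(* Indices are shifted by one: the factors 1 <= i <= j and j < i <= k are
   0 <= i < j and j <= i < k here. *)
Theorem theorem5p6 (j k : nat) (p e t : nat -> nat)
    (hj : 1 <= j) (hjk : j < k)
    (p_prime : forall i : nat, i < k -> prime (p i))
    (p_distinct : forall i l : nat, i < k -> l < k -> p i = p l -> i = l)
    (ht : forall i : nat, i < j -> 1 <= t i <= e i)
    (he : forall i : nat, j <= i < k -> 1 <= e i) :
  let S (i : 'I_j) : finGroupType := ('Z_(p i ^ e i) * 'Z_(p i ^ t i))%type in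
  let s : nat := \prod_(j <= i < k) p i ^ e i in
  let G : finGroupType := ({dffun forall i : 'I_j, S i} * 'Z_s)%type in
  generating_graph G =
  kronecker (bigkronecker (fun i : 'I_j => generating_graph (S i)))
            (looped_generating_graph 'Z_s).
Proof.
move=> S s G.
have ltk (i : 'I_j) : i < k := ltn_trans (ltn_ord i) hjk.
have pow_gt1 i n : i < k -> 0 < n -> 1 < p i ^ n.
  move=> ik n0; rewrite -{1}(expn0 (p i)) ltn_exp2l //.
  exact: prime_gt1 (p_prime i ik).
have co i l m n : i < k -> l < k -> i != l -> coprime (p i ^ m) (p l ^ n).
  move=> ik lk il; rewrite coprimeXl // coprimeXr //.
  rewrite prime_coprime ?p_prime // dvdn_prime2 ?p_prime //.
  by apply: contra il => /eqP /p_distinct ->.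
have t_gt0 (i : 'I_j) : 0 < t i by case/andP: (ht i (ltn_ord i)).
have te (i : 'I_j) : t i <= e i by case/andP: (ht i (ltn_ord i)).
have e_gt0 (i : 'I_j) : 0 < e i := leq_trans (t_gt0 i) (te i).
(* ['Z_0] and ['Z_1] have two elements, so [card_Z] needs this bound. It holds because [j < k]
   leaves at least the factor at index [j]. *)
have s_gt1 : 1 < s.
  rewrite /s big_ltn //; apply: leq_trans (pow_gt1 j (e j) hjk _) _.
    by rewrite he // leqnn.
  rewrite leq_pmulr // big_seq prodn_cond_gt0 // => i.
  by rewrite mem_index_iota => /andP[_ /p_prime/prime_gt0 p0];
    rewrite expn_gt0 p0.
have cardS (i : 'I_j) : #|S i| = p i ^ (e i + t i).
  by rewrite card_prod !card_Z ?pow_gt1 // expnD.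
have coS (i l : 'I_j) : i != l -> coprime #|S i| #|S l|.
  by move=> il; rewrite !cardS co.
have coT (i : 'I_j) : coprime #|S i| #|'Z_s|.
  rewrite cardS card_Z // /s big_seq.
  apply: (big_ind (coprime _)) => [|a b|l]; rewrite ?coprimen1 //.
    by rewrite coprimeMr => -> ->.
  rewrite mem_index_iota => /andP[jl lk]; apply: co => //.
  by rewrite neq_ltn (leq_trans (ltn_ord i) jl).
(* Here [t i <= e i] supplies the divisibility between the two prime powers. *)
have ncycS (i : 'I_j) (z : S i) : (<[z]> != [set: S i])%g.
  by apply: Z_prod_noncyclic; rewrite ?pow_gt1 // dvdn_exp2l.
apply: graph_eq => x y.
have adjS (i : 'I_j) : gen_adj (x.1 i) (y.1 i) =
    (<<[set x.1 i; y.1 i]>> == [set: S i])%g.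
  by apply: gen_adj_noncyclic; exact: ncycS.
have adjG :
  kron_adj (A := bigkronecker (fun i : 'I_j => generating_graph (S i)))
      (B := looped_generating_graph 'Z_s) x y =
  (<<[set x; y]>> == [set: G])%g.
  rewrite gen2_prod_coprime // /kron_adj /= looped_gen_adjE; congr (_ && _).
  by apply: eq_forallb => i; exact: adjS.
(* Only the requirement [x != y] on the left remains. If [x = y], adjacency on the right fails at
   factor 0, which exists since [1 <= j] and has no loops. *)
rewrite adjG /gen_adj; case: (x =P y) => //= exy.
rewrite -adjG exy /kron_adj /=; apply/esym/negbTE; rewrite negb_and.
apply/orP; left; apply/forallPn; exists (Ordinal hj).
by rewrite /= /gen_adj eqxx.
Qed.
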